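(* Let $\Omega$ be a sample space, let $\mathcal{C}\subset\mathcal{P}(\Omega)$ be a field on $\Omega$, and let $P:\mathcal{C}\to\mathbb{R}$ be a price assignment. For each of the betting systems $1$, $2$, $2B$, $2A$ and $3$, the following statements (all relative to that betting system) are equivalent: (a) $P$ is coherent; (b) $P$ is strongly coherent; (c) $P$ is rational.
   Context: $\mathcal{C}$ is the set of events for which prices are assigned; a price assignment is a function $P:\mathcal{C}\to\mathbb{R}$. $I_A$ denotes the indicator function of $A\subset\Omega$, and $\mathbb{Z}^{+}=\{1,2,3,\ldots\}$. A betting portfolio is a sequence $(\alpha_i,A_i)_{i\in\mathbb{Z}^{+}}$ with $\alpha_i\in\mathbb{R}$ and $A_i\in\mathcal{C}$. Its price is $\sum_{i=1}^{\infty}\alpha_iP(A_i)$ and its balance is $\sum_{i=1}^{\infty}\alpha_i(I_{A_i}-P(A_i))$. A betting system is a collection of betting portfolios. For given $(\Omega,\mathcal{C},P)$, the following systems consist of exactly those betting portfolios $(\alpha_i,A_i)_{i\in\mathbb{Z}^{+}}$ such that: System 1: only finitely many $\alpha_i\ne0$. System 2: $\sum_{i=1}^{\infty}|\alpha_i|P(A_i)<\infty$ and $\sum_{i=1}^{\infty}\alpha_i(I_{A_i}-P(A_i))$ converges pointwise on $\Omega$. System 2B: $\sum_{i=1}^{\infty}|\alpha_i(I_{A_i}-P(A_i))|$ is bounded on $\Omega$. System 2A: for all $w\in\Omega$, $\sum_{i=1}^{\infty}|\alpha_i(I_{A_i}(w)-P(A_i))|<\infty$. System 3: $\sum_{i=1}^{\infty}\alpha_iP(A_i)$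 converges and $\sum_{i=1}^{\infty}\alpha_i(I_{A_i}-P(A_i))$ converges pointwise on $\Omega$. Relative to a given betting system: $P$ is incoherent if there exist a betting portfolio $(\alpha_i,A_i)_{i\in\mathbb{Z}^{+}}$ in the system and $\epsilon>0$ such that for all $w\in\Omega$, $\sum_{i=1}^{\infty}\alpha_i(I_{A_i}(w)-P(A_i))\le-\epsilon$; $P$ is coherent if it is not incoherent. A set $Z\subset\Omega$ is a null set if for every $\delta>0$ there exists $Z_\delta\in\mathcal{C}$ with $Z\subset Z_\delta$ and $P(Z_\delta)<\delta$. $P$ is weakly incoherent if there exist a betting portfolio $(\alpha_i,A_i)_{i\in\mathbb{Z}^{+}}$ in the system, a null set $Z$ and $\epsilon>0$ such that for all $w\notin Z$, $\sum_{i=1}^{\infty}\alpha_i(I_{A_i}(w)-P(A_i))\le-\epsilon$; $P$ is strongly coherent if it is not weakly incoherent. $P$ is irrational if there exists a betting portfolio $(\alpha_i,A_i)_{i\in\mathbb{Z}^{+}}$ in the system such that for all $w\in\Omega$, $\sum_{i=1}^{\infty}\alpha_i(I_{A_i}(w)-P(A_i))<0$; $P$ is rational if it is not irrational.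
   Formalization: The empty set is counted as a null set by convention; under the literal definition a price such as P = 1 on every event has no null set, so it would be strongly coherent yet incoherent, and (b) would not imply (a). *)

(* Defs.v *)
From HB Require Import structures.
From mathcomp Require Import all_boot all_order all_algebra.
From mathcomp Require Import all_classical all_reals all_analysis.
Import Order.TTheory GRing.Theory Num.Theory.
Import numFieldNormedType.Exports.

Set Implicit Arguments.
Unset Strict Implicit.
Unset Printing Implicit Defensive.

Local Open Scope classical_set_scope.
Local Open Scope ring_scope.

Definition field_of_sets (Omega : Type) (C : set (set Omega)) : Prop :=
  [/\ C setT, setC_closed C & setU_closed C].

Section Betting.
Context {R : realType} {Omega : Type} {C : set (set Omega)}.
Implicit Types (P : C -> R) (Z : set Omega).

(* The sequence (alpha_i, A_i) indexed by i = 1, 2, ... is indexed here by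
   nat, starting at 0. *)
Definition portfolio := nat -> R * C.

Definition stake (b : portfolio) (i : nat) : R := (b i).1.
Definition event (b : portfolio) (i : nat) : C := (b i).2.

Definition gain P (b : portfolio) (w : Omega) (i : nat) : R :=
  stake b i * (\1_(val (event b i)) w - P (event b i)).

(* Meaningful only where the series converges, which every betting system
   below guarantees at all points of Omega. *)
Definition balance P (b : portfolio) (w : Omega) : R :=
  limn (series (gain P b w)).

Definition betting_system := set portfolio.

Definition system1 P : betting_system :=
  [set b | finite_set [set i | stake b i != 0]].

(* Prices may be negative, so finiteness of the sum of |alpha_i| P(A_i) is
   convergence of the series in R. *)
Definition system2 P : betting_system :=
  [set b | cvgn (series (fun i => `|stake b i| * P (event b i))) /\
           forall w, cvgn (series (gain P b w))].

Definition system2B P : betting_system :=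
  [set b | exists M : R, forall w,
     (\sum_(0 <= i <oo) `|gain P b w i|%:E <= M%:E)%E].

Definition system2A P : betting_system :=
  [set b | forall w, (\sum_(0 <= i <oo) `|gain P b w i|%:E < +oo)%E].

Definition system3 P : betting_system :=
  [set b | cvgn (series (fun i => stake b i * P (event b i))) /\
           forall w, cvgn (series (gain P b w))].

Definition incoherent P (B : betting_system) : Prop :=
  exists b, B b /\ exists2 e : R, 0 < e & forall w, balance P b w <= - e.

Definition coherent P B : Prop := ~ incoherent P B.

(* The empty set is null by convention. This adds something only when P is
   bounded below on C by a positive number: the covering condition then has no
   solution Z at all, and without the convention such a P (for instance P = 1
   everywhere) would be strongly coherent but incoherent. *)
Definition price_null P Z : Prop :=
  Z = set0 \/
  forall d : R, 0 < d -> exists Zd : C, Z `<=` val Zd /\ P Zd < d.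

Definition weakly_incoherent P (B : betting_system) : Prop :=
  exists b, B b /\ exists2 Z : set Omega, price_null P Z &
    exists2 e : R, 0 < e & forall w, ~ Z w -> balance P b w <= - e.

Definition strongly_coherent P B : Prop := ~ weakly_incoherent P B.

Definition irrational_price P (B : betting_system) : Prop :=
  exists b, B b /\ forall w, balance P b w < 0.

Definition rational_price P B : Prop := ~ irrational_price P B.

End Betting.

Arguments portfolio R {Omega} C.
Arguments betting_system R {Omega} C.

(* Main.v *)
Require Import Defs.
From HB Require Import structures.
From mathcomp Require Import all_boot all_order all_algebra.
From mathcomp Require Import all_classical all_reals all_analysis.
From mathcomp Require Import measurable_realfun lra ring zify.
Import Order.TTheory GRing.Theory Num.Theory.
Import numFieldNormedType.Exports.
Set Implicit Arguments.
Unset Strict Implicit.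
Unset Printing Implicit Defensive.
Local Open Scope classical_set_scope.
Local Open Scope ring_scope.

(** Strong coherence and rationality each imply coherence at once, so the point
    is that a coherent price admits neither a portfolio with balance at most
    [- e] off a null set, nor one with negative balance everywhere.

    Finitely many bets. A portfolio with finitely many bets has finitely many
    values for its balance, so negative means bounded away from [0]; and its
    balance is bounded, so a large bet against a cheap event covering the
    exceptional null set restores the inequality on that set. This settles the
    first system ([coherent_strongly1], [coherent_rational1]).

    Infinitely many bets. The other systems all contain the bets against a
    sequence of disjoint events together with the bet on its union, so there a
    coherent price is countably additive ([coherent_sigma_additive]) and extends
    to a probability measure on the generated sigma-algebra ([price_ext]). In
    the systems 2, 2A and 2B the gains are absolutely summable in mean: the mean
    of [|gain|] is twice [|stake| * p * (1 - p)], and the sum of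
    [|stake| * p * (1 - p)] is finite because of the condition on the prices,
    or because it is dominated by the sum of [|gain|] at any one point
    ([system2_variance], [system2A_variance]). Each gain has mean [0], so the
    balance has mean [0] by dominated convergence, and it cannot be negative off
    a null set ([balance_not_neg]).

    System 3. Here the series converge only conditionally and the balance need
    not be integrable, but coherence is a much stronger condition: there is no
    infinite sequence of disjoint events of positive price
    ([disjoint_events_incoherent]). Otherwise one could buy one unit of the first
    event and keep exchanging, in ever smaller amounts, the holdings in an event
    for equally priced holdings in later events; the total price stays near one
    unit while the holdings die out at every point, which leaves a balance of
    [-1]. Hence the sample space is split into finitely many atoms of the price,
    up to null sets. Given countably many events, each atom has a point that
    lies in exactly those events that contain almost all of the atom. On these
    events the price is therefore a measure with finite support
    ([finitely_mixedT]), the support avoiding a given null set. The mean of the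
    balance under that measure is [0] term by term, so the balance is not
    negative at all points of the support ([balance_not_neg3]). *)

(** * Series of gains *)

Section Series.
Context {R : realType}.
Implicit Types u v : nat -> R.

Lemma series_shift u n :
  series u n.+1 = u 0%N + series (fun i => u i.+1) n.
Proof. by rewrite /series /= big_nat_recl. Qed.

Lemma cvg_series_shift u (l : R) :
  series (fun i => u i.+1) @ \oo --> l -> series u @ \oo --> u 0%N + l.
Proof.
move=> ul; rewrite -cvg_shiftS.
have -> : [sequence series u n.+1]_n =
          (fun n => u 0%N + series (fun i => u i.+1) n).
  by apply/funext => n; rewrite /mkseq /= series_shift.
by apply: cvgD => //; exact: cvg_cst.
Qed.

Lemma series_eventually0 u N : (forall i, (N <= i)%N -> u i = 0) ->
  series u @ \oo --> series u N.
Proof.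
move=> u0; apply: (@cvg_near_cst _ _ (series u N)).
exists N => // n /= Nn.
rewrite /series /= (big_cat_nat _ (n := N)) //= [X in _ + X]big_nat_cond.
by rewrite [X in _ + X]big1 ?addr0 // => i /andP[/andP[Ni _] _]; exact: u0.
Qed.

Lemma eseries_norm_leP u (M : R) :
  (\sum_(0 <= i <oo) `|u i|%:E <= M%:E)%E <->
  forall n, series (fun i => `|u i|) n <= M.
Proof.
have u0 (i : nat) : true -> (0 <= `|u i|%:E)%E by rewrite lee_fin normr_ge0.
split=> [uM n|uM].
  rewrite -lee_fin (le_trans _ uM)// /series /= -sumEFin.
  by apply: nneseries_lim_ge => i _ _; exact: u0.
apply: lime_le; first by apply: is_cvg_nneseries => i _ _; exact: u0.
by apply: nearW => n; rewrite sumEFin lee_fin; exact: uM.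
Qed.

Lemma norm_series_ge0 u n : 0 <= series (fun i => `|u i|) n.
Proof. by apply: sumr_ge0 => i _; exact: normr_ge0. Qed.

Lemma eseries_norm_ltyP u :
  (\sum_(0 <= i <oo) `|u i|%:E < +oo)%E <->
  exists M, forall n, series (fun i => `|u i|) n <= M.
Proof.
split=> [uoo|[M /eseries_norm_leP uM]]; last first.
  by rewrite (le_lt_trans uM)// ltry.
exists (fine (\sum_(0 <= i <oo) `|u i|%:E)%E).
apply/eseries_norm_leP; rewrite fineK// ge0_fin_numE//.
by apply: nneseries_ge0 => i _ _; rewrite lee_fin normr_ge0.
Qed.

Lemma bounded_nneg_series_cvg u (M : R) : (forall i, 0 <= u i) ->
  (forall n, series u n <= M) -> cvgn (series u).
Proof.
move=> u0 uM; apply: nondecreasing_is_cvgn.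
  apply/nondecreasing_seqP => n; rewrite /series /= big_nat_recr//=.
  by rewrite lerDl.
by exists M => _ [n _ <-].
Qed.

End Series.

(** * Portfolios *)

Section Portfolios.
Context {R : realType} {Omega : Type} {C : set (set Omega)}.
Variable P : C -> R.
Implicit Types (b : portfolio R C) (B : betting_system R C) (x : R * C).

Definition bet_gain x w : R := x.1 * (\1_(val x.2) w - P x.2).

Definition bet_cons x b : portfolio R C :=
  fun i => if i is j.+1 then b j else x.

Lemma gain_cons_cvg x b w (l : R) : series (gain P b w) @ \oo --> l ->
  series (gain P (bet_cons x b) w) @ \oo --> bet_gain x w + l.
Proof. by move=> bl; exact: cvg_series_shift. Qed.

Lemma is_cvg_gain_cons x b w : cvgn (series (gain P b w)) ->
  cvgn (series (gain P (bet_cons x b) w)).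
Proof. by move=> /gain_cons_cvg bl; apply: cvgP; exact: bl. Qed.

Lemma balance_cons x b w : cvgn (series (gain P b w)) ->
  balance P (bet_cons x b) w = bet_gain x w + balance P b w.
Proof. by move=> /gain_cons_cvg bl; exact: cvg_lim (bl x). Qed.

Lemma gain_stake0 b w i : stake b i = 0 -> gain P b w i = 0.
Proof. by rewrite /gain => ->; rewrite mul0r. Qed.

Lemma gain_stake0_cvg b w N : (forall i, (N <= i)%N -> stake b i = 0) ->
  series (gain P b w) @ \oo --> series (gain P b w) N.
Proof. by move=> b0; apply: series_eventually0 => i /b0 /gain_stake0. Qed.

Lemma balance_idle b w : (forall i, stake b i = 0) -> balance P b w = 0.
Proof.
move=> b0; have /cvg_lim : series (gain P b w) @ \oo --> series (gain P b w) 0%N.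
  exact: gain_stake0_cvg.
by rewrite /series /= big_geq// => <-.
Qed.

(** What the five systems have in common: enough to play finitely many bets
    and to add them to a given portfolio. *)
Definition admissible B : Prop :=
  [/\ forall b, (forall i, stake b i = 0) -> B b,
      forall x b, B b -> B (bet_cons x b) &
      forall b, B b -> forall w, cvgn (series (gain P b w))].

Lemma system1P b :
  system1 P b <-> exists N, forall i, (N <= i)%N -> stake b i = 0.
Proof.
split=> [/finite_seqP[s sE]|[N b0]].
  exists (\max_(i <- s) i).+1 => i si; apply/eqP/negPn/negP => b_i.
  have : [set i | stake b i != 0] i by [].
  rewrite sE /= => i_s; move: si.
  by rewrite leqNgt ltnS => /negP; apply; exact: (@leq_bigmax_seq _ s predT id i).
apply: (sub_finite_set _ (finite_II N)) => i /= b_i.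
by rewrite ltnNge; apply: contra b_i => /b0 ->.
Qed.

Lemma system1_admissible : admissible (system1 P).
Proof.
split=> [b b0|x b /system1P[N b0]|b /system1P[N b0] w].
- by apply/system1P; exists 0%N.
- by apply/system1P; exists N.+1 => -[|i]//; exact: b0.
- by apply: cvgP; exact: gain_stake0_cvg b0.
Qed.

Lemma system2_admissible : admissible (system2 P).
Proof.
split=> [b b0|x b [bP bg]|b [_ bg] w].
- split=> [|w]; last by apply: cvgP; apply: (gain_stake0_cvg (N := 0%N)).
  apply: cvgP; apply: (series_eventually0 (N := 0%N)) => i _.
  by rewrite b0 normr0 mul0r.
- split=> [|w]; last exact/is_cvg_gain_cons/bg.
  by apply/cvgP/(@cvg_series_shift _ (fun i =>
    `|stake (bet_cons x b) i| * P (event (bet_cons x b) i))); exact: bP.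
- exact: bg.
Qed.

Lemma system3_admissible : admissible (system3 P).
Proof.
split=> [b b0|x b [bP bg]|b [_ bg] w].
- split=> [|w]; last by apply: cvgP; apply: (gain_stake0_cvg (N := 0%N)).
  apply: cvgP; apply: (series_eventually0 (N := 0%N)) => i _.
  by rewrite b0 mul0r.
- split=> [|w]; last exact/is_cvg_gain_cons/bg.
  by apply/cvgP/(@cvg_series_shift _ (fun i =>
    stake (bet_cons x b) i * P (event (bet_cons x b) i))); exact: bP.
- exact: bg.
Qed.

Lemma norm_gain_cons_le x b w (M : R) :
  (forall n, series (fun i => `|gain P b w i|) n <= M) ->
  forall n, series (fun i => `|gain P (bet_cons x b) w i|) n <=
            `|bet_gain x w| + M.
Proof.
move=> bM [|n].
  by rewrite /series /= big_geq// addr_ge0// (le_trans _ (bM 0%N))//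
             norm_series_ge0.
by rewrite series_shift lerD2l; exact: bM.
Qed.

Lemma norm_bet_gain_le x w : `|bet_gain x w| <= `|x.1| * (1 + `|P x.2|).
Proof.
rewrite normrM ler_wpM2l// (le_trans (ler_normB _ _))// lerD2r.
by rewrite indicE; case: (_ \in _); rewrite ?normr1 ?normr0.
Qed.

Lemma system2B_admissible : admissible (system2B P).
Proof.
split=> [b b0|x b [M bM]|b [M bM] w].
- exists 0 => w; apply/eseries_norm_leP => n; rewrite /series /= big1// => i _.
  by rewrite gain_stake0// normr0.
- exists (`|x.1| * (1 + `|P x.2|) + M) => w; apply/eseries_norm_leP => n.
  apply: (@le_trans _ _ (`|bet_gain x w| + M)).
    by apply: norm_gain_cons_le; apply/eseries_norm_leP.
  by rewrite lerD2r norm_bet_gain_le.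
- apply: normed_cvg; apply: (bounded_nneg_series_cvg (M := M)) => [i|].
    exact: normr_ge0.
  exact: (eseries_norm_leP _ _).1 (bM w).
Qed.

Lemma system2A_admissible : admissible (system2A P).
Proof.
split=> [b b0 w|x b bM w|b bM w].
- apply/eseries_norm_ltyP; exists 0 => n.
  by rewrite /series /= big1// => i _; rewrite gain_stake0// normr0.
- have /eseries_norm_ltyP[M {}bM] := bM w.
  apply/eseries_norm_ltyP; exists (`|bet_gain x w| + M).
  exact: norm_gain_cons_le.
- have /eseries_norm_ltyP[M {}bM] := bM w.
  apply: normed_cvg; apply: (bounded_nneg_series_cvg (M := M)) => // i.
  exact: normr_ge0.
Qed.

Lemma system2B_sub2A : system2B P `<=` system2A P.
Proof. by move=> b [M bM] w; rewrite (le_lt_trans (bM w))// ltry. Qed.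

End Portfolios.

(** * Finite portfolios *)

Section System1.
Context {R : realType} {Omega : Type} {C : set (set Omega)}.
Variable P : C -> R.
Implicit Types (b : portfolio R C).

Lemma balance_bounded b N : (forall i, (N <= i)%N -> stake b i = 0) ->
  exists M, forall w, balance P b w <= M.
Proof.
move=> b0; exists (\sum_(0 <= i < N) `|stake b i| * (1 + `|P (event b i)|)).
move=> w; rewrite /balance.
have /cvg_lim -> // := gain_stake0_cvg (P := P) (w := w) b0.
rewrite /series /=; apply: ler_sum => i _.
exact: (le_trans (ler_norm _) (norm_bet_gain_le P (b i) w)).
Qed.

(** A bounded balance can be corrected on a null set [Z]: a large bet against
    a cheap event covering [Z] gains little outside that event and, inside it,
    loses more than the original portfolio can gain. *)
Lemma coherent_strongly1 :
  coherent P (system1 P) -> strongly_coherent P (system1 P).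
Proof.
move=> coh [b [b1 [Z nZ [e e0 be]]]]; apply: coh.
have [_ b1c b1v] := system1_admissible P.
case: nZ => [Z0|nZ].
  by exists b; split=> //; exists e => // w; apply: be; rewrite Z0.
have /system1P[N bN] := b1; have [M bM] := balance_bounded bN.
(* The stake exceeds any balance of [b] by [e]; the price of [Zd] is small
   enough for the bet to gain less than [e / 2]. *)
pose L := `|M| + e.
have L0 : 0 < L by rewrite ltr_wpDl.
have [Zd [ZZd PZd]] := nZ (e / 2 / L) ltac:(by rewrite !divr_gt0).
exists (bet_cons (- L, Zd) b); split; first exact: b1c.
exists (e / 2) => [|w]; first by rewrite divr_gt0.
rewrite balance_cons; last exact: b1v.
have LPZd : L * P Zd < e / 2.
  by rewrite mulrC -ltr_pdivlMr.
rewrite /bet_gain /= indicE mulrBr !mulNr opprK.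
have [wZd|/negP wZd] := boolP (w \in val Zd).
  by rewrite mulr1; have := bM w; have := ler_norm M; rewrite {1}/L; lra.
rewrite mulr0 oppr0 add0r.
by have := be w (fun Zw => wZd (mem_set (ZZd w Zw))); lra.
Qed.

(** The balance of finitely many bets takes finitely many values, since it
    depends only on which of the events occur; if all of them are negative then
    they are bounded away from [0]. *)
Lemma coherent_rational1 :
  coherent P (system1 P) -> rational_price P (system1 P).
Proof.
move=> coh [b [b1 b_lt0]]; apply: coh; exists b; split=> //.
have /system1P[N bN] := b1.
pose val_of (v : {ffun 'I_N -> bool}) : R :=
  \sum_(i < N) stake b i * ((v i)%:R - P (event b i)).
have bE w : balance P b w = val_of [ffun i => w \in val (event b (i : 'I_N))].
  rewrite /balance.
  have /cvg_lim -> // := gain_stake0_cvg (P := P) (w := w) bN.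
  rewrite /series /= big_mkord /val_of; apply: eq_bigr => i _.
  by rewrite ffunE /gain indicE.
pose e := \big[Order.min/1]_(v | val_of v < 0) - val_of v.
exists e; first by apply/lt_bigmin => [|v]; rewrite ?ltr01 ?oppr_gt0.
move=> w; rewrite lerNr bE; apply: bigmin_le_cond.
by rewrite -bE.
Qed.

End System1.

(** * Coherent prices are probabilities *)

Section Price.
Context {R : realType} {Omega : Type} {C : set (set Omega)}.
Hypothesis hC : field_of_sets C.
Implicit Types (P : C -> R) (A D : set Omega).

Definition ev A (CA : C A) : C := exist _ A (mem_set CA).

Definition price P A : R := if pselect (C A) is left CA then P (ev CA) else 0.

Lemma price_ev P A (CA : C A) : price P A = P (ev CA).
Proof.
rewrite /price; case: pselect => [CA'|//].
by rewrite (Prop_irrelevance CA CA').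
Qed.

Lemma price_val P (A : C) : price P (val A) = P A.
Proof.
case: A => A inA; rewrite /= (price_ev P (set_mem inA)); congr P.
exact: val_inj.
Qed.

Lemma bet_gain_ev P (a : R) A (CA : C A) w :
  bet_gain P (a, ev CA) w = a * (\1_A w - price P A).
Proof. by rewrite /bet_gain /= (price_ev P CA). Qed.

Lemma fieldT : C setT. Proof. by have [] := hC. Qed.

Lemma fieldC A : C A -> C (~` A).
Proof. by have [_ CC _] := hC; exact: CC. Qed.

Lemma fieldU A D : C A -> C D -> C (A `|` D).
Proof. by have [_ _ CU] := hC; exact: CU. Qed.

Lemma field0 : C set0. Proof. by rewrite -setCT; exact/fieldC/fieldT. Qed.

Lemma fieldI A D : C A -> C D -> C (A `&` D).
Proof.
by move=> CA CD; rewrite -[A `&` D]setCK setCI; apply/fieldC/fieldU; exact: fieldC.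
Qed.

Lemma fieldD A D : C A -> C D -> C (A `\` D).
Proof. by move=> CA CD; rewrite setDE; apply/fieldI => //; exact: fieldC. Qed.

Lemma field_bigsetU (F : nat -> set Omega) n :
  (forall i, C (F i)) -> C (\big[setU/set0]_(i < n) F i).
Proof. by move=> CF; elim/big_ind: _ => //; [exact: field0|exact: fieldU]. Qed.

Definition probability_price P : Prop :=
  [/\ forall A, C A -> 0 <= price P A,
      price P setT = 1 &
      forall A D, C A -> C D -> A `&` D = set0 ->
        price P (A `|` D) = price P A + price P D].

Section Coherent.
Variables (P : C -> R) (B : betting_system R C).
Hypotheses (admB : admissible P B) (cohB : coherent P B).

Lemma coherent_balance_ub b (k : R) :
  B b -> (forall w, balance P b w <= k) -> 0 <= k.
Proof.
move=> Bb bk; rewrite leNgt; apply/negP => k0; apply: cohB.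
by exists b; split=> //; exists (- k) => [|w]; rewrite ?oppr_gt0 ?opprK.
Qed.

Definition idle_bets : portfolio R C := fun=> (0, ev fieldT).

Lemma idle_in : B idle_bets.
Proof. by have [B0 _ _] := admB; exact: B0. Qed.

Lemma cons_in x b : B b -> B (bet_cons x b).
Proof. by have [_ Bc _] := admB; exact: Bc. Qed.

Lemma balance_consB x b w : B b ->
  balance P (bet_cons x b) w = bet_gain P x w + balance P b w.
Proof. by have [_ _ Bv] := admB; move=> Bb; apply/balance_cons/Bv. Qed.

(** On an empty sample space every condition on the balance holds, so the idle
    portfolio makes any price incoherent. *)
Lemma coherent_inhabited : inhabited Omega.
Proof.
apply: contrapT => Omega0; suff : 0 <= -1 :> R by rewrite lerNr oppr0 ler10.
apply: (coherent_balance_ub idle_in) => w.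
by exfalso; apply: Omega0; exists.
Qed.

Lemma coherent_price_ge0 A : C A -> 0 <= price P A.
Proof.
move=> CA; apply: (@coherent_balance_ub (bet_cons (-1, ev CA) idle_bets)).
  exact/cons_in/idle_in.
move=> w; rewrite balance_consB; last exact: idle_in.
by rewrite balance_idle// addr0 bet_gain_ev mulN1r opprB gerBl indicE ler0n.
Qed.

Lemma coherent_priceT : price P setT = 1.
Proof.
have T1 (s : R) : 0 <= s * (1 - price P setT).
  apply: (@coherent_balance_ub (bet_cons (s, ev fieldT) idle_bets)).
    exact/cons_in/idle_in.
  move=> w; rewrite balance_consB; last exact: idle_in.
  by rewrite balance_idle// addr0 bet_gain_ev indicT.
by have := T1 1; have := T1 (-1); lra.
Qed.

(** The balance of these three bets is constant, and reversing all of them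
    changes its sign. *)
Lemma coherent_price_additive A D : C A -> C D -> A `&` D = set0 ->
  price P (A `|` D) = price P A + price P D.
Proof.
move=> CA CD AD0.
have AD (s : R) : 0 <= s * (price P (A `|` D) - (price P A + price P D)).
  pose b2 := bet_cons (s, ev CA) (bet_cons (s, ev CD) idle_bets).
  have Bb0 := cons_in (s, ev CD) idle_in; have Bb2 : B b2 by exact: cons_in.
  apply: (@coherent_balance_ub (bet_cons (- s, ev (fieldU CA CD)) b2)).
    exact: cons_in.
  move=> w; rewrite !balance_consB ?balance_idle ?addr0 ?bet_gain_ev//; last first.
    exact: idle_in.
  have -> : \1_(A `|` D) w = \1_A w + \1_D w :> R.
    rewrite !indicE in_setU; have [wA|] := boolP (w \in A); last by rewrite add0r.
    have [wD|] := boolP (w \in D); last by rewrite addr0.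
    have : (A `&` D) w by split; exact: set_mem.
    by rewrite AD0.
  lra.
by have := AD 1; have := AD (-1); lra.
Qed.

Lemma coherent_probability : probability_price P.
Proof.
split; [exact: coherent_price_ge0|exact: coherent_priceT|].
exact: coherent_price_additive.
Qed.

End Coherent.

End Price.

Section Probability.
Context {R : realType} {Omega : Type} {C : set (set Omega)}.
Hypothesis hC : field_of_sets C.
Variable P : C -> R.
Hypothesis probP : probability_price P.
Implicit Types A D : set Omega.

Lemma price_ge0 A : C A -> 0 <= price P A.
Proof. by have [P0 _ _] := probP; exact: P0. Qed.

Lemma priceT : price P setT = 1. Proof. by have [] := probP. Qed.

Lemma priceU A D : C A -> C D -> A `&` D = set0 ->
  price P (A `|` D) = price P A + price P D.
Proof. by have [_ _] := probP; exact. Qed.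

Lemma price0 : price P set0 = 0.
Proof.
have := priceU (field0 hC) (field0 hC) (setI0 _).
by rewrite setU0; lra.
Qed.

Lemma priceIDl A D : C A -> C D ->
  price P D = price P (D `&` A) + price P (D `\` A).
Proof.
move=> CA CD; rewrite -priceU.
- by rewrite setDE -setIUr setUCr setIT.
- exact: (fieldI hC).
- exact: (fieldD hC).
- by rewrite setDE setIACA setICr setI0.
Qed.

Lemma le_price A D : C A -> C D -> A `<=` D -> price P A <= price P D.
Proof.
move=> CA CD /setIidr AD.
by rewrite (priceIDl CA CD) AD lerDl; exact/price_ge0/(fieldD hC).
Qed.

Lemma price_le1 A : C A -> price P A <= 1.
Proof. by move=> CA; rewrite -priceT; apply: le_price => //; exact: (fieldT hC). Qed.

Lemma price_bigsetU (F : nat -> set Omega) n : (forall i, C (F i)) ->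
  trivIset setT F ->
  price P (\big[setU/set0]_(i < n) F i) = \sum_(i < n) price P (F i).
Proof.
move=> CF tF; elim: n => [|n IHn]; first by rewrite !big_ord0 price0.
rewrite !big_ord_recr/= priceU ?IHn//; first exact: (field_bigsetU hC).
rewrite -bigcup_mkord -subset0 => x [[/= m mn Fmx] Fnx].
by have := tF m n I I (ex_intro _ x (conj Fmx Fnx)); lia.
Qed.

Lemma price_bigsetU_le (F : nat -> set Omega) n D : (forall i, C (F i)) ->
  trivIset setT F -> C D -> (forall i, F i `<=` D) ->
  series (price P \o F) n <= price P D.
Proof.
move=> CF tF CD FD; rewrite /series /= big_mkord -price_bigsetU//.
apply: le_price => //; first exact: (field_bigsetU hC).
by rewrite -bigcup_mkord => x [i _]; exact: FD.
Qed.

Lemma price_null_cover (Z : set Omega) : price_null P Z ->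
  exists2 Zd : nat -> set Omega, forall n, C (Zd n) &
    (forall n, Z `<=` Zd n) /\ forall n, price P (Zd n) < n.+1%:R^-1.
Proof.
move=> [->|nZ].
  exists (fun=> set0) => [_|]; first exact: (field0 hC).
  by split=> n; [exact: subset_refl|rewrite price0 invr_gt0].
have [Zd ZdP] := choice (fun n => nZ n.+1%:R^-1 ltac:(by rewrite invr_gt0)).
exists (fun n => val (Zd n)) => [n|]; first exact/set_mem/valP.
by split=> n; have [ZZd Zdlt] := ZdP n; rewrite ?price_val.
Qed.

End Probability.

(** * Countable additivity *)

Section CountableAdditivity.
Context {R : realType} {Omega : Type} {C : set (set Omega)}.
Hypothesis hC : field_of_sets C.

Definition sigma_additive_price (P : C -> R) : Prop :=
  forall F : nat -> set Omega, (forall i, C (F i)) -> trivIset setT F ->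
    C (\bigcup_i F i) ->
    series (price P \o F) @ \oo --> price P (\bigcup_i F i).

Lemma series_indic_cvg (F : nat -> set Omega) w : trivIset setT F ->
  series (fun i => \1_(F i) w) @ \oo --> (\1_(\bigcup_i F i) w : R).
Proof.
move=> tF; have [[k _ Fkw]|nFw] := pselect ((\bigcup_i F i) w).
  have F0 i : (i != k)%N -> \1_(F i) w = 0 :> R.
    move=> ik; rewrite indicE memNset// => Fiw; move: ik.
    by rewrite (tF i k I I (ex_intro _ w (conj Fiw Fkw))) eqxx.
  have -> : \1_(\bigcup_i F i) w = series (fun i => \1_(F i) w) k.+1 :> R.
    rewrite /series /= big_nat_recr//= big_nat_cond big1 ?add0r.
      by rewrite !indicE !mem_set//; exists k.
    by move=> i /andP[/andP[_ ik] _]; rewrite F0// neq_ltn ik.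
  by apply: series_eventually0 => i ki; rewrite F0// neq_ltn ki orbT.
have F0 i : \1_(F i) w = 0 :> R.
  by rewrite indicE memNset// => Fiw; apply: nFw; exists i.
have -> : \1_(\bigcup_i F i) w = series (fun i => \1_(F i) w) 0%N :> R.
  by rewrite /series /= big_geq// indicE memNset.
exact: series_eventually0.
Qed.

(** Betting on the union of disjoint events and against each of them has a
    balance that is constant, and is minus the defect of countable additivity.
    Its gains are moreover summable uniformly on [Omega]. *)
Lemma coherent_sigma_additive (P : C -> R) (B : betting_system R C) :
  admissible P B -> coherent P B -> system2 P `&` system2B P `<=` B ->
  sigma_additive_price P.
Proof.
move=> admB cohB sub F CF tF CU; have probP := coherent_probability hC admB cohB.
have p0 i : 0 <= price P (F i) by exact: price_ge0.
have FU n : series (price P \o F) n <= price P (\bigcup_i F i).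
  by apply: (price_bigsetU_le hC) => // i; exact: bigcup_sup.
have Pcvg : cvgn (series (price P \o F)).
  by apply: bounded_nneg_series_cvg FU => i; exact: p0.
have {}FU := limr_le Pcvg (nearW _ FU).
suff UF : price P (\bigcup_i F i) <= limn (series (price P \o F)).
  have -> : price P (\bigcup_i F i) = limn (series (price P \o F)).
    by apply/eqP; rewrite eq_le UF FU.
  exact: Pcvg.
pose b : portfolio R C := fun i => (-1, ev (CF i)).
have gb w : gain P b w = (fun i => price P (F i) - \1_(F i) w).
  apply/funext => i; rewrite -[LHS]/(bet_gain P (b i) w) bet_gain_ev.
  by rewrite mulN1r opprB.
have bl w : series (gain P b w) @ \oo -->
    limn (series (price P \o F)) - \1_(\bigcup_i F i) w.
  rewrite gb; rewrite (_ : series _ = series (price P \o F) \-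
      series (fun i => \1_(F i) w)); last first.
    by apply/funext => n; rewrite /series /= sumrB.
  by apply: cvgB => //; exact: series_indic_cvg.
have [_ c2 _] := system2_admissible P; have [_ c2B _] := system2B_admissible P.
rewrite -subr_ge0.
apply: (coherent_balance_ub cohB (b := bet_cons (1, ev CU) b)).
  apply: sub; split.
    apply: c2; split=> [|w]; last by apply: cvgP; exact: bl.
    rewrite (_ : (fun i => _) = price P \o F)//; apply/funext => i.
    by rewrite /b /= normrN1 mul1r (price_ev P (CF i)).
  apply: c2B; exists (limn (series (price P \o F)) + 1) => w.
  apply/eseries_norm_leP => n.
  apply: (@le_trans _ _ (series (price P \o F) n + series (fun i => \1_(F i) w) n)).
    rewrite /series /= -big_split/=; apply: ler_sum => i _.
    rewrite gb (le_trans (ler_normB _ _))// ger0_norm// ger0_norm//.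
  apply: lerD.
    by apply: nondecreasing_cvgn_le => //; apply/nondecreasing_seqP => m;
       rewrite /series /= big_nat_recr//= lerDl.
  apply: (@le_trans _ _ (\1_(\bigcup_i F i) w)); last first.
    by rewrite indicE lern1 leq_b1.
  have /cvg_lim <- // := series_indic_cvg (w := w) tF.
  apply: nondecreasing_cvgn_le; last first.
    by apply: cvgP; exact: series_indic_cvg.
  by apply/nondecreasing_seqP => m; rewrite /series /= big_nat_recr//= lerDl.
move=> w; rewrite balance_cons; last by apply: cvgP; exact: bl.
by rewrite bet_gain_ev /balance (cvg_lim _ (bl w))//; lra.
Qed.

End CountableAdditivity.

(** * Extension to a measure *)

(** A copy of the sample space to carry the algebra of sets [C]; [w0] is the
    base point that a type of measurable elements must have. *)
Definition event_space (Omega : Type) (C : set (set Omega)) (w0 : Omega)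
  (hC : field_of_sets C) : Type := Omega.

Section EventSpace.
Context (Omega : Type) (C : set (set Omega)) (w0 : Omega).
Context (hC : field_of_sets C).

HB.instance Definition _ := gen_eqMixin (event_space w0 hC).
HB.instance Definition _ := gen_choiceMixin (event_space w0 hC).
HB.instance Definition _ := isPointed.Build (event_space w0 hC) w0.

Let event_setU : setU_closed C.
Proof. by move=> A D; exact: (fieldU hC). Qed.

Let event_setC : setC_closed C.
Proof. by move=> A; exact: (fieldC hC). Qed.

HB.instance Definition _ := @isAlgebraOfSets.Build default_measure_display
  (event_space w0 hC) C (field0 hC) event_setU event_setC.

End EventSpace.

(** The two proofs are arguments so that a measure structure can be attached to
    the function itself. *)
Definition price_measure (R : realType) (Omega : Type) (C : set (set Omega))
  (w0 : Omega) (hC : field_of_sets C) (P : C -> R)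
  (probP : probability_price P) (sigmaP : sigma_additive_price P) :
  set (event_space w0 hC) -> \bar R := fun A => (price P A)%:E.
Arguments price_measure {R Omega C} w0 hC {P} probP sigmaP.

Section PriceMeasure.
Context (R : realType) (Omega : Type) (C : set (set Omega)) (w0 : Omega).
Context (hC : field_of_sets C) (P : C -> R).
Context (probP : probability_price P) (sigmaP : sigma_additive_price P).
Let pm := price_measure w0 hC probP sigmaP.

Let pm0 : pm set0 = 0%E.
Proof. by rewrite /pm /price_measure (price0 hC). Qed.

Let pm_ge0 A : (0 <= pm A)%E.
Proof.
rewrite lee_fin; have [CA|nCA] := pselect (C A); first exact: price_ge0.
by rewrite /price; case: pselect.
Qed.

Let pm_sigma_additive : semi_sigma_additive pm.
Proof.
move=> F CF tF CU.
have -> : (fun n => \sum_(0 <= i < n) pm (F i))%E =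
    EFin \o series (price P \o F).
  by apply/funext => n; rewrite /= sumEFin.
by apply: cvg_EFin; [exact: nearW|exact: sigmaP].
Qed.

HB.instance Definition _ := isMeasure.Build _ _ _ pm
  pm0 pm_ge0 pm_sigma_additive.

End PriceMeasure.

Section Extension.
Context (R : realType) (Omega : Type) (C : set (set Omega)) (w0 : Omega).
Context (hC : field_of_sets C) (P : C -> R).
Context (probP : probability_price P) (sigmaP : sigma_additive_price P).

Definition sigma_events : measurableType _ :=
  g_sigma_algebraType (@measurable _ (event_space w0 hC)).

Definition price_ext : {measure set sigma_events -> \bar R} :=
  measure_extension (price_measure w0 hC probP sigmaP).

Lemma sigma_events_measurable (A : set Omega) :
  C A -> measurable (A : set sigma_events).
Proof. exact: sub_sigma_algebra. Qed.

Lemma price_extE (A : set Omega) : C A -> price_ext A = (price P A)%:E.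
Proof.
exact: (@measurable_mu_extE _ R (event_space w0 hC)
  (price_measure w0 hC probP sigmaP)).
Qed.
End Extension.

(** Dominated convergence, with the sum of the absolute values as dominating
    function, gives the sum of the series mean [0]; a function that is negative
    almost everywhere has mean [0] only for the zero measure. *)
Lemma mean0_series_not_ae_neg d (T : measurableType d) (R : realType)
    (mu : {measure set T -> \bar R}) (f : nat -> T -> R) :
  (forall i, measurable_fun setT (f i)) ->
  (forall i, \int[mu]_x (f i x)%:E = 0)%E ->
  (\sum_(0 <= i <oo) \int[mu]_x `|(f i x)%:E| < +oo)%E ->
  (forall x, cvgn (series (f ^~ x))) ->
  {ae mu, forall x, limn (series (f ^~ x)) < 0} -> mu setT = 0%E.
Proof.
move=> mf if0 sumf cf Xneg; pose X x := limn (series (f ^~ x)).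
have mEf i : measurable_fun setT (EFin \o f i) by exact/measurable_EFinP.
have mabs i : measurable_fun setT (abse \o (EFin \o f i)).
  exact: measurableT_comp.
have intf i : mu.-integrable setT (fun x => (f i x)%:E).
  apply/integrableP; split; first exact: mEf.
  apply: (le_lt_trans _ sumf).
  apply: (@le_trans _ _ (\sum_(0 <= k < i.+1) \int[mu]_x `|(f k x)%:E|)%E).
    rewrite big_nat_recr//= leeDr// sume_ge0// => k _.
    exact: integral_ge0.
  by apply: nneseries_lim_ge => k _ _; exact: integral_ge0.
pose S n x := (series (f ^~ x) n)%:E.
pose G x := (\sum_(0 <= i <oo) `|(f i x)%:E|)%E.
have G0 x : (0 <= G x)%E by exact: nneseries_ge0.
have mS n : measurable_fun setT (S n).
  by apply/measurable_EFinP; exact: measurable_sum.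
have mX : measurable_fun setT X.
  apply: (measurable_fun_cvg (h := fun n x => series (f ^~ x) n)) => [n|x _].
    exact: measurable_sum.
  exact: cf.
have mG : measurable_fun setT G.
  apply: (ge0_emeasurable_sum (P := xpredT)) => [i x _ _|i _].
    exact: abse_ge0.
  exact: mabs.
have SX x : S ^~ x @ \oo --> (X x)%:E.
  by apply: cvg_EFin; [exact: nearW|exact: cf].
have SG n x : (`|S n x| <= G x)%E.
  rewrite /S -sumEFin (le_trans (lee_abs_sum _ _ _))//.
  exact: nneseries_lim_ge.
have mEX : measurable_fun setT (EFin \o X) by exact/measurable_EFinP.
have iG : mu.-integrable setT G.
  apply/integrableP; split=> //.
  under eq_integral do rewrite gee0_abs//.
  by rewrite integral_nneseries// => i; exact: mabs.
have [iX _ cX] := @dominated_convergence _ _ _ mu setT measurableT S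
  (EFin \o X) G mS mEX (aeW _ (fun x _ => SX x)) iG (aeW _ (fun x n _ => SG n x)).
have S0 n : (\int[mu]_x S n x = 0)%E.
  rewrite /S /series /=; under eq_integral do rewrite -sumEFin.
  by rewrite integral_sum//= big1.
have {cX} X0 : (\int[mu]_x (X x)%:E = 0)%E.
  rewrite -(cvg_lim _ cX)//; apply: cvg_lim => //.
  by apply: cvg_near_cst; apply: nearW => n; exact: S0.
have Xabs : (\int[mu]_x `|(X x)%:E| = 0)%E.
  transitivity (\int[mu]_x - (X x)%:E)%E; last first.
    by rewrite integralN ?X0 ?oppe0// integrable_add_def.
  apply: ae_eq_integral => //.
  - by apply: measurableT_comp => //; exact/measurable_EFinP.
  - by apply: measurableT_comp => //; exact/measurable_EFinP.
  - apply: filterS Xneg => x Xx _.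
    by rewrite abse_EFin -EFinN ltr0_norm.
have /(ae_eq_integral_abs mu measurableT mEX) Xae := Xabs.
have [N [mN N0 TN]] : {ae mu, forall x : T, False}.
  apply: filterS2 Xneg Xae => x; rewrite -/(X x) => Xx /(_ I) X0x.
  by move: Xx; rewrite (EFin_inj X0x) ltxx.
by apply: (subset_measure0 measurableT mN) N0 => x _; exact: TN.
Qed.

(** * Systems with integrable balances *)

Section Expectation.
Context (R : realType) (Omega : Type) (C : set (set Omega)) (w0 : Omega).
Context (hC : field_of_sets C) (P : C -> R).
Context (probP : probability_price P) (sigmaP : sigma_additive_price P).
Let mu := price_ext w0 hC probP sigmaP.

Let muT : mu setT = 1%E.
Proof. by rewrite /mu price_extE ?priceT//; exact: fieldT. Qed.

Let integral_affine_indic (c e : R) (A : set (sigma_events w0 hC)) : C A ->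
  (\int[mu]_w (c * \1_A w + e)%:E = (c * price P A + e)%:E)%E.
Proof.
move=> CA; have mA : measurable A by exact: sigma_events_measurable.
have muA : mu A = (price P A)%:E by exact: price_extE.
have iA : mu.-integrable setT (EFin \o \1_A).
  apply/integrableP; split; first exact/measurable_EFinP/measurable_indic.
  under eq_integral do rewrite /= ger0_norm//.
  by rewrite integral_indic// setIT muA ltry.
under eq_integral do rewrite EFinD EFinM.
rewrite integralD//=.
- rewrite integralZl// integral_indic// setIT integral_cst//.
  by rewrite muA muT mule1.
- exact: integrableZl.
- by apply/integrableP; split=> //; rewrite integral_cst// muT mule1 ltry.
Qed.

Lemma price_null_negligible (Z : set Omega) : price_null P Z ->
  mu.-negligible Z.
Proof.
move=> /(price_null_cover hC probP)[Zd CZd [ZZd Zdlt]].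
pose N : set (sigma_events w0 hC) := \bigcap_n Zd n.
have mZd n : measurable (Zd n : set (sigma_events w0 hC)).
  exact: sigma_events_measurable.
have mN : measurable N by exact: bigcapT_measurable.
exists N; split=> //; last by move=> w Zw n _; exact: ZZd.
apply/eqP; rewrite eq_le measure_ge0 andbT; apply/lee_addgt0Pr => e e0.
rewrite add0e; have [n _ /(_ n (leqnn n)) ne] := near_infty_natSinv_lt (PosNum e0).
apply: (@le_trans _ _ (mu (Zd n))).
  by apply: le_measure; rewrite ?inE//; exact: bigcap_inf.
rewrite /mu price_extE// lee_fin; apply: ltW (lt_trans (Zdlt n) _).
exact: ne.
Qed.

(** The expectation of [`|gain|] is [2 * `|stake| * p * (1 - p)], [p] being the
    price of the event, so the bound makes the expected balance the sum of the
    expected gains, which vanish. *)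
Lemma balance_not_neg b (Z : set Omega) (M : R) : price_null P Z ->
  (forall n, \sum_(0 <= i < n)
    `|stake b i| * (P (event b i) * (1 - P (event b i))) <= M) ->
  (forall w, cvgn (series (gain P b w))) ->
  ~ (forall w, ~ Z w -> balance P b w < 0).
Proof.
move=> nZ bM bcvg bneg.
suff : (mu setT = 0)%E by rewrite muT => /eqP; rewrite onee_eq0.
pose p i := P (event b i); pose A i := val (event b i).
have CA i : C (A i) by exact/set_mem/valP.
have pE i : price P (A i) = p i by exact: price_val.
have p0 i : 0 <= p i by rewrite -pE; exact: price_ge0.
have p1 i : p i <= 1 by rewrite -pE; exact: (price_le1 hC).
apply: (@mean0_series_not_ae_neg _ (sigma_events w0 hC) _ mu
  (fun i w => gain P b w i)).
- move=> i; apply: measurable_funM => //; apply: measurable_funB => //.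
  by apply: measurable_indic; apply: sigma_events_measurable; exact: CA.
- move=> i; under eq_integral => w _ do
    rewrite /gain mulrBr -[X in (X)%:E]/(stake b i * \1_(A i) w - stake b i * p i).
  by rewrite integral_affine_indic// pE subrr.
- have iE i : (\int[mu]_w `|(gain P b w i)%:E| =
      (2 * (`|stake b i| * (p i * (1 - p i))))%:E)%E.
    (* [|1_A - p| = (1 - 2 p) 1_A + p] because [0 <= p <= 1] *)
    transitivity (\int[mu]_w (`|stake b i| * (1 - 2 * p i) * \1_(A i) w +
        `|stake b i| * p i)%:E)%E.
      apply: eq_integral => w _; congr EFin.
      rewrite normrM indicE -/(p i) -/(A i); case: (w \in A i) => /=.
        have q0 : 0 <= 1 - p i by rewrite subr_ge0.
        by rewrite (ger0_norm q0); ring.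
      by rewrite sub0r normrN (ger0_norm (p0 i)); ring.
    by rewrite integral_affine_indic// pE; congr EFin; ring.
  under eq_eseriesr do rewrite iE.
  apply: (@le_lt_trans _ _ (2 * M)%:E); last exact: ltry.
  apply: lime_le.
    apply: is_cvg_nneseries => i _ _.
    by rewrite lee_fin !mulr_ge0// subr_ge0.
  by apply: nearW => n; rewrite sumEFin lee_fin -mulr_sumr ler_wpM2l// bM.
- exact: bcvg.
- have [N [mN N0 ZN]] := price_null_negligible nZ.
  exists N; split=> // w /= nneg; apply: ZN.
  by apply: contrapT => /bneg.
Qed.

End Expectation.

Section IntegrableSystems.
Context {R : realType} {Omega : Type} {C : set (set Omega)}.
Hypothesis hC : field_of_sets C.
Variable P : C -> R.

Lemma event_price01 (A : C) : probability_price P -> 0 <= P A <= 1.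
Proof.
move=> probP; have CA : C (val A) by exact/set_mem/valP.
by rewrite -price_val (price_ge0 probP)//= (price_le1 hC).
Qed.

Lemma system2_variance b : probability_price P -> system2 P b ->
  exists M, forall n, \sum_(0 <= i < n)
    `|stake b i| * (P (event b i) * (1 - P (event b i))) <= M.
Proof.
move=> probP [bP _]; exists (limn (series (fun i => `|stake b i| * P (event b i)))).
move=> n; apply: (le_trans _ (nondecreasing_cvgn_le _ bP n)).
  rewrite /series /=; apply: ler_sum => i _; rewrite ler_wpM2l//.
  by have := event_price01 (event b i) probP; nra.
apply/nondecreasing_seqP => m; rewrite /series /= big_nat_recr//= lerDl mulr_ge0//.
by have /andP[] := event_price01 (event b m) probP.
Qed.

(** One point of absolute convergence suffices: there [`|gain|] is at least
    [`|stake|] times the smaller of [p] and [1 - p]. *)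
Lemma system2A_variance b (w : Omega) : probability_price P -> system2A P b ->
  exists M, forall n, \sum_(0 <= i < n)
    `|stake b i| * (P (event b i) * (1 - P (event b i))) <= M.
Proof.
move=> probP /(_ w) /eseries_norm_ltyP[M bM]; exists M => n.
apply: le_trans (bM n); rewrite /series /=; apply: ler_sum => i _.
have /andP[p0 p1] := event_price01 (event b i) probP.
rewrite normrM ler_wpM2l// indicE; case: (_ \in _) => /=.
  by rewrite ger0_norm; nra.
by rewrite sub0r normrN ger0_norm; nra.
Qed.

End IntegrableSystems.

(** * The third system forces finitely many atoms *)

Section HeapWeights.
Context {R : realType}.

(** The amount reaching node [k] when one unit poured into the root of a binary
    heap (the children of node [k] are [2k + 1] and [2k + 2]) is split equally
    at every node. *)
Definition heap_weight (k : nat) : R := (2 ^+ trunc_log 2 k.+1)^-1.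

Lemma heap_weight0 : heap_weight 0 = 1.
Proof. by rewrite /heap_weight trunc_log1 expr0 invr1. Qed.

Lemma heap_weightS j : heap_weight j.+1 = heap_weight j./2 / 2.
Proof. by rewrite /heap_weight trunc_log2S//= exprS invfM mulrC. Qed.

Lemma heap_weight_le k : 0 <= heap_weight k <= 2 / k.+1%:R.
Proof.
rewrite /heap_weight invr_ge0 exprn_ge0//= ler_pdivlMr// mulrC ler_pdivrMr ?exprn_gt0//.
rewrite -exprS -natrX ler_nat ltnW//; exact: trunc_log_ltn.
Qed.

End HeapWeights.

Section NoInfinitePartition.
Context {R : realType} {Omega : Type} {C : set (set Omega)}.
Hypothesis hC : field_of_sets C.
Variable P : C -> R.
Variables (D : nat -> set Omega) (CD : forall k, C (D k)).
Hypotheses (tD : trivIset setT D) (D0 : forall k, 0 < price P (D k)).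

Let d : nat -> R := heap_weight.

(** Each pair of bets moves the amount that node [j.+1] is due from its
    parent: it buys [D j.+1] and sells [D j./2] for that amount. *)
Definition heap_moves : portfolio R C := fun i =>
  if odd i then (- (d i./2.+1 / price P (D i./2./2)), ev (CD i./2./2))
  else (d i./2.+1 / price P (D i./2.+1), ev (CD i./2.+1)).

Let unit_of k w : R := d k * (\1_(D k) w / price P (D k)).

Let moves_price i :
  stake heap_moves i * P (event heap_moves i) = (-1) ^+ odd i * d i./2.+1.
Proof.
rewrite /stake /event /heap_moves; case: (odd i) => /=;
  rewrite -(price_ev P); have /lt0r_neq0 := D0 i./2./2;
  have /lt0r_neq0 := D0 i./2.+1 => *; by field.
Qed.

Let moves_indic i w :
  stake heap_moves i * \1_(val (event heap_moves i)) w =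
  if odd i then - (unit_of i./2./2 w / 2) else unit_of i./2.+1 w.
Proof.
rewrite /stake /event /heap_moves /unit_of; case: (odd i) => /=.
  by rewrite /d heap_weightS; ring.
by ring.
Qed.

Let moves_price_sum n :
  series (fun i => stake heap_moves i * P (event heap_moves i)) n =
  (odd n)%:R * d n./2.+1.
Proof.
elim: n => [|n IHn]; first by rewrite /series /= big_geq// mul0r.
rewrite seriesSr IHn moves_price /= uphalf_half.
by case: (odd n) => /=; rewrite ?add0n; ring.
Qed.

Let moves_price_cvg :
  series (fun i => stake heap_moves i * P (event heap_moves i)) @ \oo --> (0 : R).
Proof.
apply: (squeeze_cvgr (f := fun=> 0) (h := fun n => 4 * harmonic n)).
- apply: nearW => n; rewrite moves_price_sum.
  have /andP[d0 dn] := @heap_weight_le R n./2.+1.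
  rewrite mulr_ge0//=; apply: (@le_trans _ _ (heap_weight n./2.+1)).
    by rewrite ler_piMl//; case: (odd n).
  apply: (le_trans dn); rewrite /harmonic /= ler_pdivrMr// mulrAC ler_pdivlMr//.
  have : (n.+1)%:R <= 2 * (n./2.+2)%:R :> R by rewrite -natrM ler_nat; lia.
  lra.
- exact: cvg_cst.
- rewrite -(mulr0 4); apply: cvgM; first exact: cvg_cst.
  exact: cvg_harmonic.
Qed.

(** After the moves out of nodes [0], ..., [l.-1], the heap holds exactly the
    nodes [l], ..., [2l]. *)
Let moves_indic_sum l w :
  unit_of 0 w + series (fun i =>
    stake heap_moves i * \1_(val (event heap_moves i)) w) (4 * l)%N =
  \sum_(l <= k < l.*2.+1) unit_of k w.
Proof.
elim: l => [|l IHl].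
  by rewrite muln0 /series /= big_geq// addr0 big_nat1.
rewrite mulnS !addSn add0n !seriesSr !moves_indic.
have -> : odd (4 * l)%N = false by lia.
have -> : odd (4 * l)%N.+1 = true by lia.
have -> : odd (4 * l)%N.+2 = false by lia.
have -> : odd (4 * l)%N.+3 = true by lia.
have -> : (4 * l)%N./2 = l.*2 by lia.
have -> : ((4 * l)%N.+1)./2 = l.*2 by lia.
have -> : ((4 * l)%N.+2)./2 = l.*2.+1 by lia.
have -> : ((4 * l)%N.+3)./2 = l.*2.+1 by lia.
have -> : (l.*2)./2 = l by lia.
have -> : (l.*2.+1)./2 = l by lia.
rewrite !addrA IHl doubleS (big_ltn (m := l)); last by lia.
rewrite [RHS]big_nat_recr/=; last by lia.
rewrite [in RHS]big_nat_recr/=; last by lia.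
by field.
Qed.

Let moves_indic_cvg w :
  series (fun i => stake heap_moves i * \1_(val (event heap_moves i)) w) @ \oo
    --> - unit_of 0 w.
Proof.
have [K unitK] : exists K, forall k, (K <= k)%N -> unit_of k w = 0.
  have [[K _ DKw]|nDw] := pselect ((\bigcup_k D k) w).
    exists K.+1 => k Kk; rewrite /unit_of indicE memNset ?mul0r ?mulr0// => Dkw.
    by have := tD I I (ex_intro _ w (conj Dkw DKw)); lia.
  exists 0%N => k _; rewrite /unit_of indicE memNset ?mul0r ?mulr0// => Dkw.
  by apply: nDw; exists k.
have := moves_indic_sum K w; rewrite [RHS]big_nat_cond big1; last first.
  by move=> k /andP[/andP[Kk _] _]; exact: unitK.
move=> /eqP; rewrite addrC addr_eq0 => /eqP <-.
apply: series_eventually0 => i Ki; rewrite moves_indic.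
by case: (odd i); rewrite unitK ?mul0r ?oppr0//; lia.
Qed.

(** Buying [D 0] for one unit and then moving it down the heap costs one unit
    in the limit, while the holdings vanish at every point, because the events
    are disjoint. *)
Lemma disjoint_events_incoherent : ~ coherent P (system3 P).
Proof.
apply; have [_ c3 _] := system3_admissible P.
have gcvg w : series (gain P heap_moves w) @ \oo --> - unit_of 0 w - 0.
  have -> : series (gain P heap_moves w) =
    series (fun i => stake heap_moves i * \1_(val (event heap_moves i)) w) \-
    series (fun i => stake heap_moves i * P (event heap_moves i)).
    apply/funext => n; rewrite /series /= -sumrB; apply: eq_bigr => i _.
    by rewrite -mulrBr.
  by apply: cvgB; [exact: moves_indic_cvg|exact: moves_price_cvg].
exists (bet_cons ((price P (D 0%N))^-1, ev (CD 0%N)) heap_moves); split.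
  apply: c3; split=> [|w]; apply: cvgP; first exact: moves_price_cvg.
  exact: gcvg.
exists 1 => // w; rewrite balance_cons; last by apply: cvgP; exact: gcvg.
rewrite bet_gain_ev /balance (cvg_lim _ (gcvg w))// /unit_of /d heap_weight0.
have /lt0r_neq0 := D0 0%N => p0.
by rewrite [leLHS](_ : _ = -1)//; field.
Qed.

End NoInfinitePartition.

Section FiniteMixtures.
Context {R : realType} {Omega : Type}.
Implicit Types (A D : set Omega) (E : set Omega -> R).

(** Measures with finite support in [A]. The inductive form lets two mixtures be
    joined, and the points of one be pruned, by recursion on the support. *)
Inductive finite_mixture A : (set Omega -> R) -> Prop :=
| Mixture0 : finite_mixture A (fun=> 0)
| MixtureS (p : R) w E : 0 < p -> A w -> finite_mixture A E ->
    finite_mixture A (fun D => p * \1_D w + E D).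

Lemma finite_mixture_ge0 A E : finite_mixture A E -> forall D, 0 <= E D.
Proof.
elim=> [|p w {}E p0 _ _ IHE] D //.
by rewrite addr_ge0// mulr_ge0// ltW.
Qed.

Lemma finite_mixtureD A E1 E2 : finite_mixture A E1 -> finite_mixture A E2 ->
  finite_mixture A (E1 \+ E2).
Proof.
move=> mE1 mE2; elim: mE1 => [|p w E p0 Aw _ IHE].
  by rewrite (_ : _ \+ _ = E2)//; apply/funext => D /=; rewrite add0r.
rewrite (_ : _ \+ _ = (fun D => p * \1_D w + (E \+ E2) D)); first exact: MixtureS.
by apply/funext => D /=; rewrite addrA.
Qed.

Lemma finite_mixture_sub A A' E : A `<=` A' ->
  finite_mixture A E -> finite_mixture A' E.
Proof.
by move=> AA'; elim=> [|p w {}E p0 /AA' Aw _]; [exact: Mixture0|exact: MixtureS].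
Qed.

(** A point in all the sets [Zd n] would give them the weight of that point at
    least. *)
Lemma finite_mixture_avoid A E (Zd : nat -> set Omega) (Z : set Omega) :
  (forall n, Z `<=` Zd n) -> (forall n, E (Zd n) < n.+1%:R^-1) ->
  finite_mixture A E -> finite_mixture (A `\` Z) E.
Proof.
move=> ZZd + mE; elim: mE => [_|p w {}E p0 Aw mE IHE Elt]; first exact: Mixture0.
apply: MixtureS => //; last first.
  apply: IHE => n; apply: le_lt_trans (Elt n).
  by rewrite lerDr mulr_ge0// ltW.
split=> // Zw.
have [n _ /(_ n (leqnn n)) /= np] := near_infty_natSinv_lt (PosNum p0).
have := lt_trans (Elt n) np; rewrite indicE mem_set ?mulr1; last exact: ZZd.
by have := finite_mixture_ge0 mE (Zd n); lra.
Qed.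

End FiniteMixtures.

Section System3.
Context {R : realType} {Omega : Type} {C : set (set Omega)}.
Hypothesis hC : field_of_sets C.
Variable P : C -> R.
Hypotheses (probP : probability_price P) (sigmaP : sigma_additive_price P).
Hypothesis cohP : coherent P (system3 P).

(** The mixture depends on the sequence of events: its points have to avoid the
    null sets that these events cut out, and in general no point avoids all
    null sets at once. *)
Definition finitely_mixed (A : set Omega) : Prop :=
  forall F : nat -> set Omega, (forall i, C (F i)) ->
  exists2 E, finite_mixture A E &
    E setT = price P A /\ forall i, E (F i) = price P (F i `&` A).

Lemma finitely_mixed0 A : C A -> price P A = 0 -> finitely_mixed A.
Proof.
move=> CA PA0 F CF; exists (fun=> 0); first exact: Mixture0.
split=> // i; apply/esym/eqP; rewrite eq_le (price_ge0 probP) ?andbT.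
  by rewrite -PA0 (le_price hC)//; exact: (fieldI hC).
exact: (fieldI hC).
Qed.

Lemma finitely_mixedU A D : C A -> C D -> A `&` D = set0 ->
  finitely_mixed A -> finitely_mixed D -> finitely_mixed (A `|` D).
Proof.
move=> CA CD AD0 mA mD F CF.
have [E1 mE1 [E1T E1F]] := mA F CF; have [E2 mE2 [E2T E2F]] := mD F CF.
exists (E1 \+ E2).
  apply: finite_mixtureD; first by apply: finite_mixture_sub mE1 => w; left.
  by apply: finite_mixture_sub mE2 => w; right.
split=> [|i] /=; first by rewrite E1T E2T (priceU probP).
rewrite E1F E2F setIUr (priceU probP)//; try exact: (fieldI hC).
by rewrite setIACA AD0 setI0.
Qed.

(** In an atom [A], countably many events lie, up to a null set, outside [A] or
    around [A]; a point off these null sets sees each event as the price does. *)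
Lemma finitely_mixed_atom A : C A -> 0 < price P A ->
  (forall D, C D -> D `<=` A -> price P D = 0 \/ price P D = price P A) ->
  finitely_mixed A.
Proof.
move=> CA PA0 atomA F CF.
(* [N i] is the null one of the two parts of [A] determined by [F i]. *)
pose N i := if price P (F i `&` A) == 0 then F i `&` A else A `\` F i.
have CFA i : C (F i `&` A) by exact: (fieldI hC).
have CN i : C (N i) by rewrite /N; case: ifP => _ //; exact: (fieldD hC).
have PN i : price P (N i) = 0.
  rewrite /N; case: ifPn => [/eqP//|PFA].
  have [PFA0|PFAA] := atomA _ (CFA i) (@subIsetr _ _ _).
    by rewrite PFA0 eqxx in PFA.
  by have := priceIDl hC probP (CF i) CA; rewrite setIC PFAA; lra.
have [w Aw nNw] : exists2 w, A w & ~ (\bigcup_i N i) w.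
  apply: contrapT => nw; have AN : A `<=` \bigcup_i N i.
    by move=> w Aw; apply: contrapT => nNw; apply: nw; exists w.
  have [w0 _] : A !=set0.
    apply/set0P/eqP => A0; move: PA0.
    by rewrite A0 (price0 hC probP) ltxx.
  pose mu := price_ext w0 hC probP sigmaP.
  have mA : measurable (A : set (sigma_events w0 hC)).
    exact: sigma_events_measurable.
  have negN i : mu.-negligible (N i).
    exists (N i); split=> //; first exact: sigma_events_measurable.
    by rewrite /mu price_extE ?PN.
  have /(negligibleP mu mA) :=
    @negligibleS _ (sigma_events w0 hC) _ mu _ _ AN (negligible_bigcup negN).
  have muA : mu A = (price P A)%:E by exact: price_extE.
  by move=> /(etrans (esym muA)) [PAz]; rewrite PAz ltxx in PA0.
exists (fun D => price P A * \1_D w + 0); first exact/MixtureS/Mixture0.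
split=> [|i]; first by rewrite indicT mulr1 addr0.
rewrite addr0 indicE; have nNi : ~ N i w by move=> Niw; apply: nNw; exists i.
move: nNi; rewrite /N; case: ifPn => [/eqP -> nFA|PFA nAF].
  by rewrite memNset ?mulr0// => Fw; apply: nFA.
rewrite mem_set ?mulr1; last by apply: contrapT => nFw; apply: nAF.
by have [PFA0|->] := atomA _ (CFA i) (@subIsetr _ _ _); first by rewrite PFA0 eqxx in PFA.
Qed.

(** An event that is not finitely mixed is neither null nor an atom, so it has
    two complementary parts of positive price; they cannot both be finitely
    mixed. *)
Lemma not_finitely_mixed_split A : C A -> ~ finitely_mixed A ->
  exists D, [/\ C D, ~ finitely_mixed D, D `<=` A & 0 < price P (A `\` D)].
Proof.
move=> CA nA.
have PA0 : 0 < price P A.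
  rewrite lt_neqAle (price_ge0 probP)// andbT eq_sym.
  by apply/eqP => /(finitely_mixed0 CA).
have [D [CD DA PD0 PDA]] : exists D, [/\ C D, D `<=` A, price P D != 0 &
    price P D != price P A].
  apply: contrapT => nD; apply: nA; apply: finitely_mixed_atom => // D CD DA.
  have [|PD0] := eqVneq (price P D) 0; first by left.
  have [|PDA] := eqVneq (price P D) (price P A); first by right.
  by exfalso; apply: nD; exists D.
have DAE : A `&` D = D by exact/setIidr.
have PAD := priceIDl hC probP CD CA; rewrite DAE in PAD.
have CAD : C (A `\` D) by exact: (fieldD hC).
have PD_ge0 := price_ge0 probP CD; have PAD_ge0 := price_ge0 probP CAD.
have ADD : A `\` (A `\` D) = D by rewrite setDD.
have [mD|nD] := pselect (finitely_mixed D); last first.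
  exists D; split=> //; rewrite lt_neqAle PAD_ge0 andbT.
  by apply: contra PDA => /eqP PAD0; rewrite PAD -PAD0 addr0.
exists (A `\` D); split=> //.
- move=> mAD; apply: nA; rewrite -(setDUK DA).
  apply: finitely_mixedU => //.
  by rewrite setDE setICA setICr setI0.
- by rewrite ADD lt_neqAle eq_sym PD0.
Qed.

(** Otherwise splitting forever leaves behind infinitely many disjoint events of
    positive price. *)
Lemma finitely_mixedT : finitely_mixed setT.
Proof.
apply: contrapT => nT.
pose Bad := {A : set Omega | C A /\ ~ finitely_mixed A}.
pose next (X Y : Bad) := sval Y `<=` sval X /\ 0 < price P (sval X `\` sval Y).
have [X|f [_ fS]] := @dependent_choice Bad next _
    (exist _ setT (conj (fieldT hC) nT)).
  apply: cid; have [CX nX] := svalP X.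
  have [D [CD nD DX PXD]] := not_finitely_mixed_split CX nX.
  by exists (exist _ D (conj CD nD)).
have f_sub m n : (m <= n)%N -> sval (f n) `<=` sval (f m).
  move=> /subnK <-; elim: (n - m)%N => [|k IHk]; first by rewrite add0n.
  by rewrite addSn; apply: subset_trans IHk; have [] := fS (k + m)%N.
pose D k := sval (f k) `\` sval (f k.+1).
apply: (@disjoint_events_incoherent _ _ _ P D) => //.
- by move=> k; apply: (fieldD hC); [case: (svalP (f k))|case: (svalP (f k.+1))].
- move=> i j _ _ [w [[fi nfi] [fj nfj]]].
  case: (ltngtP i j) => // ij; exfalso; [apply: nfi|apply: nfj].
  + exact: f_sub fj.
  + exact: f_sub fi.
- by move=> k; have [] := fS k.
Qed.

(** The mean of the balance under a mixture is the same positive combination of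
    its values at finitely many points; only there do the series of gains have
    to be added up, so that conditional convergence is enough. *)
Lemma finite_mixture_balance b E :
  finite_mixture [set w | cvgn (series (gain P b w)) /\ balance P b w < 0] E ->
  exists2 l : R,
    series (fun i => stake b i * (E (val (event b i)) - P (event b i) * E setT))
      @ \oo --> l &
    l <= 0 /\ (0 < E setT -> l < 0).
Proof.
elim=> [|p w {}E p0 [bw bw0] mE [l El [l0 l0lt]]].
  exists 0; last by rewrite ltxx.
  rewrite [X in X @ _](_ : _ = cst 0); first exact: cvg_cst.
  by apply/funext => n; rewrite /series /= big1// => i _; rewrite mulr0 subrr mulr0.
exists (p * balance P b w + l).
  rewrite [X in X @ _](_ : _ = (fun n => p * series (gain P b w) n +
    series (fun i => stake b i * (E (val (event b i)) - P (event b i) * E setT)) n)).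
    by apply: cvgD => //; apply: cvgM => //; exact: cvg_cst.
  apply/funext => n; rewrite /series /= mulr_sumr -big_split/=.
  apply: eq_bigr => i _; rewrite /gain (_ : \1_setT w = 1 :> R) ?indicT//.
  by ring.
have pb0 : p * balance P b w < 0 by rewrite pmulr_rlt0.
by split=> [|_]; lra.
Qed.

(** For a mixture that agrees with the price on the events of the portfolio all
    the terms of the mean balance vanish; the sets that cover [Z] are included
    among the events to keep the points of the mixture out of [Z]. *)
Lemma balance_not_neg3 b (Z : set Omega) : price_null P Z -> system3 P b ->
  ~ (forall w, ~ Z w -> balance P b w < 0).
Proof.
move=> /(price_null_cover hC probP)[Zd CZd [ZZd Zdlt]] [_ bcvg] bneg.
(* the events of the portfolio and the covers of [Z], interleaved *)
pose F i := if odd i then Zd i./2 else val (event b i./2).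
have CF i : C (F i) by rewrite /F; case: odd => //; exact/set_mem/valP.
have [E mE [ET EF]] := finitely_mixedT CF.
have EZd n : E (Zd n) = price P (Zd n).
  by have := EF n.*2.+1; rewrite /F /= odd_double uphalf_double setIT.
have Eb i : E (val (event b i)) = P (event b i).
  by have := EF i.*2; rewrite /F /= odd_double doubleK setIT price_val.
have /finite_mixture_balance[l bl [_ /(_ _)]] : finite_mixture
    [set w | cvgn (series (gain P b w)) /\ balance P b w < 0] E.
  have EZlt n : E (Zd n) < n.+1%:R^-1 by rewrite EZd.
  apply: finite_mixture_sub (finite_mixture_avoid ZZd EZlt mE) => w [_ nZw].
  by split; [exact: bcvg|exact: bneg].
rewrite ET priceT// ltr01 => /(_ isT).
rewrite -(cvg_lim _ bl)//.
rewrite (_ : series _ = cst 0) ?lim_cst ?ltxx//.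
by apply/funext => n; rewrite /series /= big1// => i _; rewrite Eb ET priceT//; ring.
Qed.

End System3.

(** * The equivalences *)

Section Equivalences.
Context {R : realType} {Omega : Type} {C : set (set Omega)}.
Variable P : C -> R.
Implicit Types B : betting_system R C.

Lemma strongly_coherent_coherent B : strongly_coherent P B -> coherent P B.
Proof.
move=> scoh [b [Bb [e e0 be]]]; apply: scoh.
by exists b; split=> //; exists set0; [left|exists e].
Qed.

Lemma rational_coherent B : rational_price P B -> coherent P B.
Proof.
move=> rat [b [Bb [e e0 be]]]; apply: rat.
by exists b; split=> // w; rewrite (le_lt_trans (be w))// oppr_lt0.
Qed.

Lemma coherence_equiv B :
  (coherent P B -> strongly_coherent P B) ->
  (coherent P B -> rational_price P B) ->
  [<-> coherent P B; strongly_coherent P B; rational_price P B].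
Proof.
move=> cs cr; tfae; first exact: cs.
- by move=> /strongly_coherent_coherent/cr.
- exact: rational_coherent.
Qed.

(** Both a weakly incoherent and an irrational portfolio have a negative balance
    off a null set, so excluding such portfolios at once settles both. *)
Lemma not_neg_equiv B :
  (coherent P B -> forall b Z, B b -> price_null P Z ->
     ~ (forall w, ~ Z w -> balance P b w < 0)) ->
  [<-> coherent P B; strongly_coherent P B; rational_price P B].
Proof.
move=> nneg; apply: coherence_equiv => coh [b [Bb]].
  move=> [Z nZ [e e0 be]]; apply: (nneg coh b Z Bb nZ) => w /be.
  by move=> /le_lt_trans; apply; rewrite oppr_lt0.
by move=> b0; apply: (nneg coh b set0 Bb (or_introl erefl)) => w _.
Qed.

Hypothesis hC : field_of_sets C.

(** The common treatment of the systems in which the gains are summable in mean;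
    [p * (1 - p)] is the variance of the indicator of an event of price [p]. *)
Lemma variance_equiv B : admissible P B -> system2 P `&` system2B P `<=` B ->
  (forall (w : Omega) b, probability_price P -> B b ->
     exists M, forall n, \sum_(0 <= i < n)
       `|stake b i| * (P (event b i) * (1 - P (event b i))) <= M) ->
  [<-> coherent P B; strongly_coherent P B; rational_price P B].
Proof.
move=> admB sub var; apply: not_neg_equiv => coh b Z Bb nZ.
have probP := coherent_probability hC admB coh.
have sigmaP := coherent_sigma_additive hC admB coh sub.
have [w0] := coherent_inhabited hC admB coh.
have [M bM] := var w0 b probP Bb; have [_ _ Bv] := admB.
exact: (balance_not_neg w0 hC probP sigmaP nZ bM (Bv b Bb)).
Qed.

Lemma system2_sub3 : probability_price P -> system2 P `<=` system3 P.
Proof.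
move=> probP b [bP bg]; split=> //; apply: normed_cvg => /=.
have E : (fun i => `|stake b i * P (event b i)|) =
    (fun i => `|stake b i| * P (event b i)).
  apply/funext => i; rewrite normrM; congr (_ * _).
  by rewrite ger0_norm//; have /andP[] := event_price01 hC (event b i) probP.
by move: bP; rewrite -E; exact.
Qed.

End Equivalences.

Theorem theorem6 (R : realType) (Omega : Type) (C : set (set Omega))
    (hC : field_of_sets C) (P : C -> R) :
  [/\ [<-> coherent P (system1 P);
           strongly_coherent P (system1 P);
           rational_price P (system1 P)],
      [<-> coherent P (system2 P);
           strongly_coherent P (system2 P);
           rational_price P (system2 P)],
      [<-> coherent P (system2B P);
           strongly_coherent P (system2B P);
           rational_price P (system2B P)],
      [<-> coherent P (system2A P);
           strongly_coherent P (system2A P);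
           rational_price P (system2A P)]
    & [<-> coherent P (system3 P);
           strongly_coherent P (system3 P);
           rational_price P (system3 P)]].
Proof.
split.
- by apply: coherence_equiv; [exact: coherent_strongly1|exact: coherent_rational1].
- apply: (variance_equiv hC) => [||w b]; first exact: system2_admissible.
    by move=> b [].
  exact: system2_variance.
- apply: (variance_equiv hC) => [||w b]; first exact: system2B_admissible.
    by move=> b [].
  by move=> probP /system2B_sub2A; exact: (system2A_variance hC w).
- apply: (variance_equiv hC) => [||w b]; first exact: system2A_admissible.
    by move=> b [_ /system2B_sub2A].
  exact: (system2A_variance hC w).
- apply: not_neg_equiv => coh b Z b3 nZ.
  have adm3 := system3_admissible P.
  have probP := coherent_probability hC adm3 coh.
  apply: (balance_not_neg3 hC probP _ coh nZ b3).
  apply: (coherent_sigma_additive hC adm3 coh) => b' [b2 _].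
  exact: (system2_sub3 hC probP).
Qed.
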